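(* Let $(R,\mathfrak m)$ be a Cohen-Macaulay local ring with $\dim R=1$. Then the following assertions hold true. (1) Let $I$ be an Ulrich ideal of $R$ and $A=I:I$. Let $a_1,a_2,\ldots,a_n\in\mathfrak m$ ($n\ge 2$) and assume that $I=a_1a_2\cdots a_nA$. For $1\le i\le n$, let $I_i=(a_1a_2\cdots a_i)+I$. Then each $I_i$ is an Ulrich ideal of $R$ and $$I=I_n\subsetneq I_{n-1}\subsetneq\cdots\subsetneq I_1.$$ (2) Conversely, let $I_1,I_2,\ldots,I_n$ ($n\ge 2$) be Ulrich ideals of $R$ and suppose that $I_n\subsetneq I_{n-1}\subsetneq\cdots\subsetneq I_1$. Set $I=I_n$ and $A=I:I$. Then there exist elements $a_1,a_2,\ldots,a_n\in\mathfrak m$ such that $I=a_1a_2\cdots a_nA$ and $I_i=(a_1a_2\cdots a_i)+I$ for all $1\le i\le n-1$.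
   Context: Local rings are Noetherian. $\mathrm{Q}(R)$ denotes the total ring of fractions of $R$. For $R$-submodules $X,Y$ of $\mathrm{Q}(R)$, $X:Y=\{x\in \mathrm{Q}(R)\mid xY\subseteq X\}$; in particular $A=I:I$ is a subring of $\mathrm{Q}(R)$ containing $R$. An $\mathfrak m$-primary ideal $I$ of $R$ is called an Ulrich ideal if it contains a parameter ideal $Q=(a)$ of $R$ as a reduction and satisfies: (1) $I\neq Q$, (2) $I^2=QI$, and (3) $I/I^2$ is a free $R/I$-module. (Conditions (1) and (2) together do not depend on the choice of the reduction $Q$.) For elements of $R$, $(x_1,x_2,\ldots)$ denotes the ideal of $R$ they generate. *)

(* Defs.v *)
From HB Require Import structures.
From mathcomp Require Import all_boot all_algebra generic_quotient.
From mathcomp Require Import boolp classical_sets.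
From mathcomp Require Import ring.

Set Implicit Arguments.
Unset Strict Implicit.
Unset Printing Implicit Defensive.

Import GRing.Theory.
Local Open Scope classical_set_scope.
Local Open Scope ring_scope.
Local Open Scope quotient_scope.

(* The total ring of fractions Q(R): pairs (numerator, denominator) whose
   denominator is a nonzerodivisor of R ([GRing.lreg]), modulo
   a/s ~ b/t iff a t = s b.  MathComp's {fraction R} covers domains only. *)
Section TotalFrac.
Variable R : comNzRingType.

Record preratio := PreRatio {
  numden :> R * R;
  _ : `[< GRing.lreg numden.2 >] }.

HB.instance Definition _ := [isSub for numden].
HB.instance Definition _ := [Choice of preratio by <:].

Implicit Types x y z : preratio.

Lemma denP x : GRing.lreg (numden x).2.
Proof. by case: x => p /= /asboolP. Qed.

Definition mkratio (a s : R) (hs : GRing.lreg s) : preratio :=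
  @PreRatio (a, s) (asboolT hs).

Definition eqratio x y := x.1 * y.2 == x.2 * y.1.

Lemma eqratio_refl : reflexive eqratio.
Proof. by move=> x; rewrite /eqratio mulrC. Qed.

Lemma eqratio_sym : symmetric eqratio.
Proof.
by move=> x y; rewrite /eqratio eq_sym; congr (_ == _); rewrite mulrC.
Qed.

Lemma eqratio_trans : transitive eqratio.
Proof.
move=> y x z /eqP xy /eqP yz; apply/eqP; apply: (denP (x := y)).
have -> : y.2 * (x.1 * z.2) = x.1 * y.2 * z.2 by ring.
have -> : y.2 * (x.2 * z.1) = x.2 * (y.2 * z.1) by ring.
by rewrite xy -yz; ring.
Qed.

Canonical eqratio_equiv :=
  EquivRel eqratio eqratio_refl eqratio_sym eqratio_trans.

Definition total_frac := {eq_quot eqratio}.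

HB.instance Definition _ : EqQuotient _ eqratio total_frac :=
  EqQuotient.on total_frac.
HB.instance Definition _ := Choice.on total_frac.

Lemma repr_pi x :
  x.1 * (repr (\pi_total_frac x)).2 = x.2 * (repr (\pi_total_frac x)).1.
Proof.
have : (x == repr (\pi_total_frac x) %[mod total_frac]) by rewrite reprK.
by rewrite eqmodE => /eqP.
Qed.

Definition ratio_of (a : R) := mkratio a (@GRing.lreg1 R).

(* the canonical map R -> Q(R), a |-> a/1 *)
Definition to_total_frac := lift_embed total_frac ratio_of.
Canonical to_total_frac_pi_morph := PiEmbed to_total_frac.

Definition addratio x y :=
  mkratio (x.1 * y.2 + y.1 * x.2) (GRing.lregM (denP (x := x)) (denP (x := y))).
Definition oppratio x := mkratio (- x.1) (denP (x := x)).
Definition mulratio x y :=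
  mkratio (x.1 * y.1) (GRing.lregM (denP (x := x)) (denP (x := y))).

Definition tf_add := lift_op2 total_frac addratio.
Definition tf_opp := lift_op1 total_frac oppratio.
Definition tf_mul := lift_op2 total_frac mulratio.

Lemma tf_pi_add :
  {morph \pi_total_frac : x y / addratio x y >-> tf_add x y}.
Proof.
move=> x y; unlock tf_add; apply/eqmodP; apply/eqP => /=.
have := repr_pi x; have := repr_pi y.
move: (repr _) (repr _) => x' y' hy hx.
rewrite mulrDr mulrDl.
have -> : x.1 * y.2 * (x'.2 * y'.2) = (x.1 * x'.2) * (y.2 * y'.2) by ring.
have -> : y.1 * x.2 * (x'.2 * y'.2) = (y.1 * y'.2) * (x.2 * x'.2) by ring.
by rewrite hx hy; ring.
Qed.
Canonical tf_pi_add_morph := PiMorph2 tf_pi_add.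

Lemma tf_pi_opp : {morph \pi_total_frac : x / oppratio x >-> tf_opp x}.
Proof.
move=> x; unlock tf_opp; apply/eqmodP; apply/eqP => /=.
by rewrite mulNr mulrN repr_pi.
Qed.
Canonical tf_pi_opp_morph := PiMorph1 tf_pi_opp.

Lemma tf_pi_mul :
  {morph \pi_total_frac : x y / mulratio x y >-> tf_mul x y}.
Proof.
move=> x y; unlock tf_mul; apply/eqmodP; apply/eqP => /=.
by rewrite mulrACA !repr_pi mulrACA.
Qed.
Canonical tf_pi_mul_morph := PiMorph2 tf_pi_mul.

Lemma tf_addA : associative tf_add.
Proof.
elim/quotW=> x; elim/quotW=> y; elim/quotW=> z; rewrite !piE.
by apply/eqmodP; apply/eqP => /=; ring.
Qed.

Lemma tf_addC : commutative tf_add.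
Proof.
elim/quotW=> x; elim/quotW=> y; rewrite !piE.
by apply/eqmodP; apply/eqP => /=; ring.
Qed.

Lemma tf_add0 : left_id (to_total_frac 0) tf_add.
Proof.
elim/quotW=> x; rewrite !piE.
by apply/eqmodP; apply/eqP => /=; ring.
Qed.

Lemma tf_addN : left_inverse (to_total_frac 0) tf_opp tf_add.
Proof.
elim/quotW=> x; rewrite !piE.
by apply/eqmodP; apply/eqP => /=; ring.
Qed.

HB.instance Definition _ :=
  GRing.isZmodule.Build total_frac tf_addA tf_addC tf_add0 tf_addN.

Lemma tf_mulA : associative tf_mul.
Proof.
elim/quotW=> x; elim/quotW=> y; elim/quotW=> z; rewrite !piE.
by apply/eqmodP; apply/eqP => /=; ring.
Qed.

Lemma tf_mulC : commutative tf_mul.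
Proof.
elim/quotW=> x; elim/quotW=> y; rewrite !piE.
by apply/eqmodP; apply/eqP => /=; ring.
Qed.

Lemma tf_mul1 : left_id (to_total_frac 1) tf_mul.
Proof.
elim/quotW=> x; rewrite !piE.
by apply/eqmodP; apply/eqP => /=; ring.
Qed.

Lemma tf_mulDl : left_distributive tf_mul tf_add.
Proof.
elim/quotW=> x; elim/quotW=> y; elim/quotW=> z; rewrite !piE.
by apply/eqmodP; apply/eqP => /=; ring.
Qed.

Lemma tf_one_neq0 : to_total_frac 1 != to_total_frac 0.
Proof.
apply/eqP; rewrite !piE => /eqmodP /eqP /= /eqP.
by rewrite !mulr1 mulr0 oner_eq0.
Qed.

HB.instance Definition _ :=
  GRing.Zmodule_isComNzRing.Build total_frac
    tf_mulA tf_mulC tf_mul1 tf_mulDl tf_one_neq0.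

Lemma to_total_frac_is_zmod_morphism : zmod_morphism to_total_frac.
Proof.
move=> a b; rewrite /= -[RHS]/(tf_add (to_total_frac a) (tf_opp (to_total_frac b))) !piE.
by apply/eqmodP; apply/eqP => /=; ring.
Qed.

HB.instance Definition _ := GRing.isZmodMorphism.Build R total_frac to_total_frac
  to_total_frac_is_zmod_morphism.

Lemma to_total_frac_is_monoid_morphism : monoid_morphism to_total_frac.
Proof.
split=> // a b; rewrite -[RHS]/(tf_mul (to_total_frac a) (to_total_frac b)) !piE.
by apply/eqmodP; apply/eqP => /=; ring.
Qed.

HB.instance Definition _ := GRing.isMonoidMorphism.Build R total_frac to_total_frac
  to_total_frac_is_monoid_morphism.

Lemma to_total_frac_inj : injective to_total_frac.
Proof.
by move=> a b; rewrite !piE => /eqmodP /eqP /=; rewrite mulr1 mul1r.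
Qed.

Lemma to_total_frac_unit (s : R) :
  GRing.lreg s -> exists u : total_frac, u * to_total_frac s = 1.
Proof.
move=> hs; exists (\pi_total_frac (mkratio 1 hs)).
rewrite -[LHS]/(tf_mul _ _) -[RHS]/(to_total_frac 1) !piE.
by apply/eqmodP; apply/eqP => /=; ring.
Qed.

Lemma total_fracP (x : total_frac) :
  exists a s : R, GRing.lreg s /\ x * to_total_frac s = to_total_frac a.
Proof.
elim/quotW: x => x; exists x.1, x.2; split; first exact: denP.
rewrite -[LHS]/(tf_mul _ _) !piE.
by apply/eqmodP; apply/eqP => /=; ring.
Qed.

End TotalFrac.

Arguments total_frac : clear implicits.
Arguments to_total_frac {R}.

Section Ideals.
Variable R : comNzRingType.
Implicit Types (I J M N P Q m : set R) (s : seq R).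

(* Unlike MathComp's [idealr_closed], the unit ideal is allowed. *)
Definition is_ideal I : Prop :=
  [/\ I 0, forall x y, I x -> I y -> I (x + y)
         & forall c x, I x -> I (c * x)].

Definition ideal_gen (G : set R) : set R := smallest is_ideal G.

Definition ideal_add I J : set R := [set x + y | x in I & y in J].

Definition ideal_mul I J : set R := ideal_gen [set x * y | x in I & y in J].

(* I^0 = R, and I^1 = I definitionally *)
Definition ideal_exp I (n : nat) : set R := iterop n ideal_mul I setT.

Definition is_prime P : Prop :=
  [/\ is_ideal P, ~ P 1 & forall x y, P (x * y) -> P x \/ P y].

Definition is_maximal m : Prop :=
  [/\ is_ideal m, ~ m 1
    & forall J, is_ideal J -> ~ J 1 -> m `<=` J -> J = m].

Definition radical I : set R := [set x | exists n, I (x ^+ n)].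

Definition is_primary I : Prop :=
  [/\ is_ideal I, ~ I 1
    & forall x y, I (x * y) -> I x \/ exists n, I (y ^+ n)].

Definition primary_to m I : Prop := is_primary I /\ radical I = m.

Definition noetherian : Prop :=
  forall I, is_ideal I -> exists s, I = ideal_gen [set` s].

(* (R, m) is a local ring; local rings are Noetherian *)
Definition local_ring m : Prop :=
  [/\ noetherian, is_maximal m & forall n, is_maximal n -> n = m].

Definition has_prime_chain (k : nat) : Prop :=
  exists P : nat -> set R,
    (forall i, (i <= k)%N -> is_prime (P i)) /\
    (forall i, (i < k)%N -> P i `<` P i.+1).

Definition krull_dim (d : nat) : Prop :=
  has_prime_chain d /\ forall k, has_prime_chain k -> (k <= d)%N.

Definition regular_seq s : Prop :=
  ~ ideal_gen [set` s] 1 /\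
  forall i, (i < size s)%N -> forall y,
    ideal_gen [set` take i s] (s`_i * y) -> ideal_gen [set` take i s] y.

Definition depth m (d : nat) : Prop :=
  (exists s, [/\ [set` s] `<=` m, regular_seq s & size s = d]) /\
  forall s, [set` s] `<=` m -> regular_seq s -> (size s <= d)%N.

Definition cohen_macaulay m : Prop :=
  local_ring m /\ exists2 d, krull_dim d & depth m d.

(* generated by a system of parameters: dim R elements whose ideal is m-primary *)
Definition parameter_ideal m Q : Prop :=
  exists s, [/\ krull_dim (size s), Q = ideal_gen [set` s] & primary_to m Q].

Definition reduction Q I : Prop :=
  Q `<=` I /\ exists n, ideal_exp I n.+1 = ideal_mul Q (ideal_exp I n).

(* For ideals N <= M with I M <= N, the R/I-module M/N is free.  B consists of
   representatives of a basis: its elements span M modulo N, and a linear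
   combination of distinct elements of B that vanishes in M/N has all its
   coefficients zero in R/I.  The coefficients c b are representatives in R. *)
Definition free_quotient I M N : Prop :=
  exists B : set R,
    [/\ B `<=` M,
        forall x, M x -> exists (s : seq R) (c : R -> R),
          [set` s] `<=` B /\ N (x - \sum_(b <- s) c b * b)
      & forall (s : seq R) (c : R -> R), uniq s -> [set` s] `<=` B ->
          N (\sum_(b <- s) c b * b) -> forall b, b \in s -> I (c b)].

Definition ulrich m I : Prop :=
  primary_to m I /\
  exists a : R, let Q := ideal_gen [set a] in
    [/\ parameter_ideal m Q /\ reduction Q I,
        I <> Q,
        ideal_exp I 2 = ideal_mul Q I
      & free_quotient I I (ideal_exp I 2)].

Definition colon (X Y : set (total_frac R)) : set (total_frac R) :=
  [set x | forall y, Y y -> X (x * y)].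

(* I : I, for an ideal I of R viewed inside Q(R) *)
Definition self_colon I : set (total_frac R) :=
  colon (to_total_frac @` I) (to_total_frac @` I).

End Ideals.

Arguments noetherian : clear implicits.
Arguments krull_dim : clear implicits.
Arguments has_prime_chain : clear implicits.

(* Main.v *)
Require Import Defs.
From mathcomp Require Import all_boot all_algebra.
From mathcomp Require Import boolp classical_sets.
From mathcomp Require Import ring.

(** Throughout, A = I : I and B = J : J inside Q(R).

    If I is Ulrich and b is a regular element of I with I^2 = b I, then
    I = b A, and multiplication by b turns A / R into I / (b).  Freeness of
    I / I^2 over R / I amounts to freeness of I / (b), that is of A / R; this
    reformulation (ulrich_change_generator, ulrich_at_ulrich) carries both
    halves, because it behaves well when A is shrunk.

    First half.  Let I = b c A with b, c in the maximal ideal m, and put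
    J = (b) + I.  Then J = b (R + c A), where R + c A is a ring, so that
    J^2 = b J.  A basis x_1, .., x_r of I / (bc) is also a basis of J / (b): it
    spans because I does, and a relation among the x_k modulo (b), multiplied
    by c, becomes a relation modulo (bc), so its coefficients y satisfy
    c y \in I, which forces y \in J (ulrich_at_add).  The inclusions are strict
    because b \in I is incompatible with c \in m (ulrich_at_not_mem).

    Second half.  The chain is built one step at a time: given Ulrich ideals
    I < J with J = b B, there is c in m with I = b c A and J = (b) + I
    (ulrich_at_factor).  Freeness gives R : I = A and R : J = B, hence B is
    contained in A.  Put L = I :_R J.  As B / R is the part of the free module
    A / R killed by J, one has B = R + L A; since b L A lies in I, this yields
    J = (b) + I.  It remains to find c \in L with I = b c A.  Write I = a A and
    a = b d; then L is contained in d A.  Choose t outside J with t m inside J,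
    and c \in L with t c outside I; such a c exists, since t L inside I would
    force t \in R : B = J.  Write c = d w with w \in A.  If v \in A satisfies
    v w \in m A, then t c v \in t m d A, which lies in J d A and hence in I, and
    freeness of A / I over R / I gives v \in m A.  So w is regular on A / m A, a
    finite-dimensional algebra over R / m; therefore w is a unit of A
    (unit_of_regular_mod_max_ext), and I = b d A = b c A. *)

Set Implicit Arguments.
Unset Strict Implicit.
Unset Printing Implicit Defensive.

Import GRing.Theory.
Local Open Scope classical_set_scope.
Local Open Scope ring_scope.

(** * Generated ideals and linear combinations *)

Section Generation.
Variable R : comNzRingType.
Implicit Types (I J N B G m : set R) (s t : seq R) (a b x y : R).

Lemma is_idealN I x : is_ideal I -> I x -> I (- x).
Proof. by move=> [_ _ IM] Ix; rewrite -mulN1r; apply: IM. Qed.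

Lemma is_idealD I x y : is_ideal I -> I x -> I y -> I (x + y).
Proof. by case=> _ ID _; apply: ID. Qed.

Lemma is_idealB I x y : is_ideal I -> I x -> I y -> I (x - y).
Proof. by move=> idI Ix Iy; apply: is_idealD => //; apply: is_idealN. Qed.

Lemma is_idealMl I x y : is_ideal I -> I y -> I (x * y).
Proof. by case=> _ _; apply. Qed.

Lemma is_idealMr I x y : is_ideal I -> I x -> I (x * y).
Proof. by rewrite mulrC; apply: is_idealMl. Qed.

Lemma is_ideal_sum I s (P : pred R) (F : R -> R) : is_ideal I ->
  (forall b, b \in s -> P b -> I (F b)) -> I (\sum_(b <- s | P b) F b).
Proof.
move=> [I0 ID _] IF; rewrite big_seq_cond.
by apply: (big_ind I) => // b /andP[]; apply: IF.
Qed.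

Lemma ideal_gen_is_ideal G : is_ideal (ideal_gen G).
Proof.
split=> [J [[]]//|x y Gx Gy J [idJ GJ]|c x Gx J [idJ GJ]].
  by apply: is_idealD => //; [apply: Gx|apply: Gy].
by apply: is_idealMl => //; apply: Gx.
Qed.

Lemma sub_ideal_gen G : G `<=` ideal_gen G.
Proof. by move=> x Gx J [_]; apply. Qed.

Lemma ideal_gen_min G I : is_ideal I -> G `<=` I -> ideal_gen G `<=` I.
Proof. by move=> idI GI x Gx; apply: Gx; split. Qed.

Lemma ideal_gen1P a x : ideal_gen [set a] x <-> exists r, x = r * a.
Proof.
split=> [|[r ->]]; last first.
  by apply: (is_idealMl r (ideal_gen_is_ideal [set a])); exact: sub_ideal_gen.
apply: (@ideal_gen_min _ [set y | exists r, y = r * a] _ _ x) => [|y ->]; last first.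
  by exists 1; rewrite mul1r.
split=> [|_ _ [u ->] [v ->]|c _ [u ->]].
- by exists 0; rewrite mul0r.
- by exists (u + v); rewrite mulrDl.
- by exists (c * u); rewrite mulrA.
Qed.

Lemma ideal_add_is_ideal I J :
  is_ideal I -> is_ideal J -> is_ideal (ideal_add I J).
Proof.
move=> idI idJ; split.
- by case: idI idJ => I0 _ _ [J0 _ _]; exists 0 => //; exists 0; rewrite ?addr0.
- move=> _ _ [x Ix [y Jy <-]] [x' Ix' [y' Jy' <-]].
  exists (x + x'); first exact: is_idealD.
  by exists (y + y'); [exact: is_idealD|ring].
- move=> c _ [x Ix [y Jy <-]].
  exists (c * x); first exact: is_idealMl.
  by exists (c * y); [exact: is_idealMl|ring].
Qed.

Lemma ideal_add_gen1P a I x :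
  ideal_add (ideal_gen [set a]) I x <-> exists r, exists2 y, I y & x = r * a + y.
Proof.
split=> [[_ /ideal_gen1P[r ->] [y Iy <-]]|[r [y Iy ->]]]; first by exists r, y.
by exists (r * a); [apply/ideal_gen1P; exists r|exists y].
Qed.

Lemma is_ideal_colon a I : is_ideal I -> is_ideal [set x | I (a * x)].
Proof.
move=> idI; split=> [|x y Ix Iy|c x Ix] /=.
- by rewrite mulr0; case: idI.
- by rewrite mulrDr; apply: is_idealD.
- by rewrite mulrCA; apply: is_idealMl.
Qed.

Lemma is_ideal_scale a I :
  is_ideal I -> is_ideal [set x | exists2 y, I y & x = a * y].
Proof.
move=> idI; split=> [|_ _ [x Ix ->] [y Iy ->]|c _ [x Ix ->]].
- by exists 0; rewrite ?mulr0//; case: idI.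
- by exists (x + y); [apply: is_idealD|ring].
- by exists (c * x); [apply: is_idealMl|ring].
Qed.

Lemma ideal_mul_min I J K : is_ideal K ->
  (forall x y, I x -> J y -> K (x * y)) -> ideal_mul I J `<=` K.
Proof.
by move=> idK IJK; apply: ideal_gen_min => // _ [x Ix [y Jy <-]]; apply: IJK.
Qed.

Lemma mem_ideal_mul I J x y : I x -> J y -> ideal_mul I J (x * y).
Proof. by move=> Ix Jy; apply: sub_ideal_gen; exists x => //; exists y. Qed.

Lemma sub_ideal_add a I : I `<=` ideal_add (ideal_gen [set a]) I.
Proof.
by move=> x Ix; apply/ideal_add_gen1P; exists 0, x; rewrite ?mul0r ?add0r.
Qed.

Lemma mem_ideal_add a I : is_ideal I -> ideal_add (ideal_gen [set a]) I a.
Proof.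
by case=> I0 _ _; apply/ideal_add_gen1P; exists 1, 0; rewrite ?mul1r ?addr0.
Qed.

Lemma ideal_add_min a I J : is_ideal J -> J a -> I `<=` J ->
  ideal_add (ideal_gen [set a]) I `<=` J.
Proof.
move=> idJ Ja IJ _ /ideal_add_gen1P[r [y /IJ Jy ->]].
by apply: is_idealD => //; apply: is_idealMl.
Qed.

Lemma sum_extend s t (c : R -> R) :
  uniq s -> uniq t -> {subset s <= t} ->
  \sum_(b <- s) c b * b = \sum_(b <- t) (if b \in s then c b else 0) * b.
Proof.
move=> us ut st.
under [RHS]eq_bigr do rewrite (fun_if (fun z => z * _)) mul0r.
rewrite -big_mkcond -big_filter; apply: perm_big.
apply: uniq_perm => //; first exact: filter_uniq.
move=> b; rewrite mem_filter; case: (boolP (b \in s)) => //= bs.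
by rewrite st.
Qed.

(** Taking the list duplicate-free costs nothing and matches the shape of the
    independence clause of [free_quotient]. *)
Lemma ideal_gen_combP B x :
  ideal_gen B x <-> exists s (c : R -> R),
    [/\ uniq s, [set` s] `<=` B & x = \sum_(b <- s) c b * b].
Proof.
split=> [|[s [c [_ sB ->]]]]; last first.
  apply: (is_ideal_sum (ideal_gen_is_ideal B)) => b bs _.
  exact: (is_idealMl _ (ideal_gen_is_ideal B) (sub_ideal_gen (sB b bs))).
pose C := [set x | exists s (c : R -> R),
    [/\ uniq s, [set` s] `<=` B & x = \sum_(b <- s) c b * b]].
apply: (@ideal_gen_min _ C _ _ x) => [|b Bb]; last first.
  exists [:: b], (fun=> 1); split=> //; last by rewrite big_seq1 mul1r.
  by move=> y /=; rewrite inE => /eqP ->.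
split.
- by exists [::], (fun=> 0); split=> //; rewrite big_nil.
- move=> _ _ [s [c [us sB ->]]] [s' [c' [us' sB' ->]]].
  exists (undup (s ++ s')), (fun b =>
    (if b \in s then c b else 0) + (if b \in s' then c' b else 0)).
  split; first exact: undup_uniq.
    move=> b /=; rewrite mem_undup mem_cat => /orP[]; [exact: sB|exact: sB'].
  under [RHS]eq_bigr do rewrite mulrDl.
  by rewrite big_split /=; congr (_ + _);
    rewrite -sum_extend ?undup_uniq// => b bs; rewrite mem_undup mem_cat bs ?orbT.
- move=> r _ [s [c [us sB ->]]]; exists s, (fun b => r * c b); split=> //.
  by rewrite big_distrr /=; apply: eq_bigr => b _; rewrite mulrA.
Qed.

(** The spanning clause of [free_quotient] says that M lies in (B) + N; in this
    form it can be proved and used by ideal-theoretic means, without lists. *)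
Lemma spans_moduloP N B x :
  (exists (s : seq R) (c : R -> R),
     [set` s] `<=` B /\ N (x - \sum_(b <- s) c b * b)) <->
  exists2 y, ideal_gen B y & N (x - y).
Proof.
split=> [[s [c [sB Nx]]]|[y /ideal_gen_combP[s [c [_ sB ->]]] Nx]]; last first.
  by exists s, c.
exists (\sum_(b <- s) c b * b) => //.
apply: (is_ideal_sum (ideal_gen_is_ideal B)) => b bs _.
exact: (is_idealMl _ (ideal_gen_is_ideal B) (sub_ideal_gen (sB b bs))).
Qed.

Lemma spanning_nonempty I N B :
  (forall x, I x -> exists (s : seq R) (c : R -> R),
     [set` s] `<=` B /\ N (x - \sum_(b <- s) c b * b)) ->
  ~ I `<=` N -> exists d, B d.
Proof.
move=> spanB nIN; apply: contrapT => nB; apply: nIN => x /spanB[[|d s] [c [sB]]].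
  by rewrite big_nil subr0.
by case: nB; exists d; apply: sB; apply: mem_head.
Qed.

Lemma independent_coef I N B k d :
  (forall (s : seq R) (c : R -> R), uniq s -> [set` s] `<=` B ->
     N (\sum_(b <- s) c b * b) -> forall b, b \in s -> I (c b)) ->
  B d -> N (k * d) -> I k.
Proof.
move=> indB Bd Nkd; apply: (indB [:: d] (fun=> k)) (mem_head _ _) => //.
  by move=> e /=; rewrite inE => /eqP->.
by rewrite big_seq1.
Qed.

End Generation.

(** * Local rings and primary ideals *)

Section LocalRings.
Variable R : comNzRingType.
Implicit Types (I J N B G m : set R) (s : seq R) (a b t x y : R).

(** Zorn's lemma on the proper ideals above I.  The empty set is admitted as a
    member because the union of the empty chain is empty. *)
Lemma maximal_ideal_exists I :
  is_ideal I -> ~ I 1 -> exists2 n, is_maximal n & I `<=` n.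
Proof.
move=> idI I1.
pose P X := X = set0 \/ [/\ is_ideal X, ~ X 1 & I `<=` X].
have PI : P I by right; split.
have [F FP Ftot|A [PA Amax]] := @Zorn_bigcup R P.
  have [->|/eqP/set0P[x [X FX Xx]]] := pselect (\bigcup_(X in F) X = set0).
    by left.
  right.
  have FI Y y : F Y -> Y y -> [/\ is_ideal Y, ~ Y 1 & I `<=` Y].
    by move=> FY Yy; case: (FP _ FY) => // Y0; rewrite Y0 in Yy.
  have [idX X1 IX] := FI _ _ FX Xx.
  split; last by move=> y Iy; exists X => //; apply: IX.
    split.
    - by exists X => //; case: idX.
    - move=> y z [Y FY Yy] [Z FZ Zz].
      have [YZ|ZY] := Ftot _ _ FY FZ.
        exists Z => //; have [? _ _] := FI _ _ FZ Zz.
        by apply: is_idealD => //; exact: YZ.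
      exists Y => //; have [? _ _] := FI _ _ FY Yy.
      by apply: is_idealD => //; exact: ZY.
    - move=> c y [Y FY Yy]; exists Y => //.
      by have [? _ _] := FI _ _ FY Yy; apply: is_idealMl.
  by move=> [Y FY Y1]; have [] := FI _ _ FY Y1.
have [A0|[idA A1 IA]] := PA.
  exfalso; apply: (Amax I) => //; rewrite A0; split=> // I0.
  by have [/I0] := idI.
exists A => //; split=> // J idJ J1 AJ; apply: contrapT => nJA.
apply: (Amax J); last by right; split=> //; exact: subset_trans AJ.
by split=> // JA; apply: nJA; rewrite eqEsubset.
Qed.

Lemma local_unit m x : local_ring m -> ~ m x -> exists y, x * y = 1.
Proof.
move=> [_ _ m_uniq] mx.
have [/ideal_gen1P[r ->]|x1] := pselect (ideal_gen [set x] 1).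
  by exists r; rewrite mulrC.
have [n nmax xn] := maximal_ideal_exists (ideal_gen_is_ideal _) x1.
by case: mx; rewrite -(m_uniq n nmax); apply: xn; exact: sub_ideal_gen.
Qed.

(** Treat the elements of s one at a time, multiplying t each time by the last
    power of x that keeps it outside I.  Such multipliers are used below where
    one would expect Nakayama's lemma. *)
Lemma radical_socle_seq I t s : is_ideal I -> ~ I t ->
  (forall x, x \in s -> radical I x) ->
  exists2 r, ~ I (r * t) & forall x, x \in s -> I (x * (r * t)).
Proof.
move=> idI It; elim: s => [|x s IHs] sI; first by exists 1; rewrite ?mul1r.
have [|r Irt rs] := IHs; first by move=> y ys; apply: sI; rewrite inE ys orbT.
have [|k xk] := sI x; first exact: mem_head.
have ex_k : exists k, `[< I (x ^+ k * (r * t)) >].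
  by exists k; apply/asboolP; apply: is_idealMr.
case: (ex_minnP ex_k) => [[|n]] /asboolP In n_min.
  by rewrite expr0 mul1r in In.
exists (x ^+ n * r); first by rewrite -mulrA => /asboolP/n_min; rewrite ltnn.
move=> y; rewrite inE -!mulrA => /predU1P[->|ys]; first by rewrite mulrA -exprS.
by rewrite mulrCA; apply: is_idealMl => //; apply: rs.
Qed.

(** A socle element of R / I among the multiples of t. *)
Lemma radical_socle I m t : noetherian R -> is_ideal I -> is_ideal m ->
  m `<=` radical I -> ~ I t ->
  exists2 r, ~ I (r * t) & forall x, m x -> I (x * (r * t)).
Proof.
move=> noethR idI idm mI It; have [s m_s] := noethR m idm.
have [|r Irt rs] := @radical_socle_seq I t s idI It.
  by move=> x xs; apply: mI; rewrite m_s; exact: sub_ideal_gen.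
exists r => // x; rewrite m_s [x * _]mulrC.
apply: (ideal_gen_min (is_ideal_colon (r * t) idI)) => y /rs /=.
by rewrite [y * _]mulrC.
Qed.

(** An element y outside m is a unit modulo I: 1 = r y + z with z \in m, and
    1 - z^k is a multiple of 1 - z = r y. *)
Lemma radical_maximal_primary m I :
  is_maximal m -> is_ideal I -> ~ I 1 -> radical I = m -> primary_to m I.
Proof.
move=> [idm m1 mmax] idI I1 radI; split=> //; split=> // x y Ixy.
have [my|my] := pselect (m y); first by right; rewrite -radI in my.
left; pose J := ideal_add (ideal_gen [set y]) m.
have idJ : is_ideal J by apply: ideal_add_is_ideal => //; apply: ideal_gen_is_ideal.
have [J1|J1] := pselect (J 1); last first.
  case: my; rewrite -(mmax J) //; last first.
    exact: sub_ideal_add.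
  exact: mem_ideal_add.
move/ideal_add_gen1P: J1 => [r [z mz eq1]].
move: mz; rewrite -radI => -[k Izk].
have -> : x = x * (1 - z ^+ k) + x * z ^+ k by ring.
apply: is_idealD => //; last exact: is_idealMl.
rewrite -{1}(expr1n _ k) subrXX {1}eq1.
set S := \sum_(i < _) _.
have -> : x * ((r * y + z - z) * S) = r * S * (x * y) by ring.
exact: is_idealMl.
Qed.

End LocalRings.

(** * Stable ideals and a change of generator *)

Section UlrichIdeals.
Variable R : comNzRingType.
Implicit Types (I J N B G m : set R) (s : seq R) (a b t x y : R).

(** For an ideal I this says I^2 = b I with b a regular element of I, that is
    I = b (I : I); see [stable_image]. *)
Definition stable_at b I : Prop :=
  [/\ I b, GRing.lreg b
    & forall x y, I x -> I y -> exists2 z, I z & x * y = b * z].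

(** The Ulrich condition seen through b: I / (b) corresponds to (I : I) / R,
    and it is this module, rather than I / I^2, that is required to be free. *)
Definition ulrich_at m b I : Prop :=
  [/\ is_ideal I, ~ I 1, radical I = m, stable_at b I
    & ~ I `<=` ideal_gen [set b] /\ free_quotient I I (ideal_gen [set b])].

Lemma ideal_mul_genl a I x : is_ideal I ->
  ideal_mul (ideal_gen [set a]) I x <-> exists2 z, I z & x = a * z.
Proof.
move=> idI; split=> [|[z Iz ->]]; last first.
  by apply: mem_ideal_mul => //; apply: sub_ideal_gen.
apply: (ideal_mul_min (is_ideal_scale a idI)) => _ z /ideal_gen1P[r ->] Iz.
by exists (r * z); [apply: is_idealMl|ring].
Qed.

Lemma ideal_exp2_stable b I x : is_ideal I -> stable_at b I ->
  ideal_exp I 2 x <-> exists2 z, I z & x = b * z.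
Proof.
move=> idI [Ib _ IIb]; split=> [|[z Iz ->]]; last exact: mem_ideal_mul.
exact: (ideal_mul_min (is_ideal_scale b idI)).
Qed.

Lemma lreg_factor x y : GRing.lreg (x * y) -> GRing.lreg x.
Proof. by move=> reg u v /= uv; apply: reg; rewrite /= mulrAC uv mulrAC. Qed.

(** Depth equals dimension, so a maximal regular sequence has length one. *)
Lemma cohen_macaulay_regular m : cohen_macaulay m -> krull_dim R 1 ->
  exists2 f, m f & GRing.lreg f.
Proof.
move=> [_ [d [chain_d d_max] [[s [sm [_ reg_s] size_s]] _]]] [chain1 max1].
have d1 : d = 1 by apply/eqP; rewrite eqn_leq max1 //= d_max.
case: s sm reg_s size_s => [|f [|g s]] sm reg_s; rewrite d1 // => _.
exists f; first by apply: sm; rewrite /= inE.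
move=> u v /= fuv; apply/eqP; rewrite -subr_eq0; apply/eqP.
have id0 : is_ideal [set (0 : R)].
  by split=> [//|x y /= -> ->|c x /= ->]; rewrite ?addr0 ?mulr0.
have : ideal_gen [set` take 0 [:: f]] (f * (u - v)).
  by rewrite mulrBr fuv subrr; have [] := ideal_gen_is_ideal [set` take 0 [:: f]].
move=> /(reg_s 0%N isT); apply: (@ideal_gen_min _ _ [set 0]) => //.
Qed.

(** The generator a of the reduction is regular because some power of a regular
    element of m is a multiple of a. *)
Lemma ulrich_stable m I : cohen_macaulay m -> krull_dim R 1 ->
  ulrich m I -> exists b, stable_at b I.
Proof.
move=> hCM hdim [[[idI _ _] _] [a /= [[[s [_ Qs [_ radQ]]] [QI _]] _ I2 _]]].
exists a; split.
- by apply: QI; apply: sub_ideal_gen.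
- have [f mf reg_f] := cohen_macaulay_regular hCM hdim.
  rewrite -radQ in mf; case: mf => k /ideal_gen1P[r fk].
  apply: (@lreg_factor _ r); rewrite mulrC -fk.
  elim: k {fk} => [|k IHk]; first by rewrite expr0; apply: GRing.lreg1.
  by rewrite exprS; apply: GRing.lregM.
- move=> x y Ix Iy.
  have : ideal_mul I I (x * y) by apply: mem_ideal_mul.
  by rewrite I2 => /ideal_mul_genl; apply.
Qed.

(** Exchange argument.  Expand b on a basis of I / I^2.  Some coefficient lies
    outside m: otherwise a multiplier r outside I killing all the coefficients
    modulo I would put r b in I^2 = b I, hence r in I.  That coefficient is a
    unit, so b can replace the corresponding basis element d0, and the other
    basis elements form a basis of I / (b). *)
Lemma ulrich_change_generator m I b : local_ring m ->
  ulrich m I -> stable_at b I -> ulrich_at m b I.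
Proof.
move=> loc [[[idI I1 _] radI] [a [[_ [QI _]] IneqQ I2 [B [BI spanB indB]]]]] stabI.
have E x := ideal_exp2_stable x idI stabI.
have [Ib reg_b IIb] := stabI.
split=> //; split.
  move=> Ib_gen; apply: IneqQ; rewrite eqEsubset; split=> // x Ix.
  have : ideal_exp I 2 (b * x) by apply/E; exists x.
  rewrite I2 => /ideal_mul_genl[]// z /Ib_gen/ideal_gen1P[r ->] eqx.
  by apply/ideal_gen1P; exists r; apply: reg_b; rewrite /= eqx; ring.
have [_ /ideal_gen_combP[s [c [us sB ->]]] /E[q Iq bq]] :=
  (spans_moduloP _ _ _).1 (spanB b Ib).
have [d0 ds0 md0] : exists2 d0, d0 \in s & ~ m (c d0).
  apply: contrapT => nd0; have [|r Ir rs] := radical_socle_seq (s := map c s) idI I1.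
    move=> _ /mapP[d ds ->]; rewrite radI; apply: contrapT => md.
    by apply: nd0; exists d.
  rewrite mulr1 in Ir rs; apply: Ir.
  have /E[w Iw Ew] : ideal_exp I 2 (r * \sum_(d <- s) c d * d).
    rewrite big_distrr /=; apply: (is_ideal_sum (ideal_gen_is_ideal _)) => d ds _.
    rewrite mulrA; apply: mem_ideal_mul; last exact/BI/sB.
    by rewrite mulrC; apply: rs; apply: map_f.
  suff -> : r = r * q + w by apply: is_idealD => //; apply: is_idealMl.
  by apply: reg_b; rewrite /= mulrDr -Ew mulrCA -bq; ring.
have [u cu] := local_unit loc md0.
have Bd0 : B d0 by apply: sB.
exists [set d | B d /\ d <> d0]; split=> [d [Bd _]|x Ix|t k ut tB].
- exact: BI.
- apply/spans_moduloP; set B1 := [set d | _].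
  have idB1 := ideal_gen_is_ideal B1.
  have BK : B `<=` ideal_add (ideal_gen [set b]) (ideal_gen B1).
    move=> d Bd; apply/ideal_add_gen1P; have [->|dd0] := eqVneq d d0; last first.
      exists 0, d; last by rewrite mul0r add0r.
      by apply: sub_ideal_gen; split=> //; apply/eqP.
    exists (u * (1 - q)), (- u * \sum_(d <- s | d != d0) c d * d).
      apply: (is_idealMl _ idB1); apply: (is_ideal_sum idB1) => e es ed0.
      by apply: (is_idealMl _ idB1); apply: sub_ideal_gen; split; [exact: sB|exact/eqP].
    move: bq; rewrite (bigD1_seq d0) //=; set S := \sum_(_ <- _ | _) _ => bq.
    have -> : u * (1 - q) * b = u * (b - b * q) by ring.
    by rewrite -bq -[LHS]mul1r -cu; ring.
  have [y yB /E[z Iz Ez]] := (spans_moduloP _ _ _).1 (spanB x Ix).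
  have /ideal_add_gen1P[r [y' y'B Ey]] := ideal_gen_min
    (ideal_add_is_ideal (ideal_gen_is_ideal _) idB1) BK yB.
  exists y' => //; apply/ideal_gen1P; exists (r + z).
  by rewrite -[x](subrK y) Ez Ey; ring.
- move=> /ideal_gen1P[r Er].
  have tB' : [set` undup (t ++ s)] `<=` B.
    by move=> d /=; rewrite mem_undup mem_cat => /orP[/tB[]|/sB].
  have ind := indB (undup (t ++ s)) (fun d => (if d \in t then k d else 0) -
    r * (if d \in s then c d else 0)) (undup_uniq _) tB'.
  have {ind} ind : forall d, d \in undup (t ++ s) ->
      I ((if d \in t then k d else 0) - r * (if d \in s then c d else 0)).
    apply: ind; under eq_bigr do rewrite mulrBl -mulrA.
    rewrite sumrB -big_distrr /= -!sum_extend ?undup_uniq//; last first.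
    + by move=> d dt; rewrite mem_undup mem_cat dt.
    + by move=> d ds; rewrite mem_undup mem_cat ds orbT.
    apply/E; exists (r * q); first exact: is_idealMl.
    by rewrite Er mulrCA -bq; ring.
  (* d0 does not occur in t, so its coefficient is - r times a unit *)
  have Ir : I r.
    have := ind d0; rewrite mem_undup mem_cat ds0 orbT => /(_ isT).
    have /negbTE-> : d0 \notin t by apply/negP => /tB[].
    move=> Irc; have -> : r = - u * (0 - r * c d0).
      by rewrite -[LHS]mulr1 -cu; ring.
    exact: is_idealMl.
  move=> d dt; have := ind d; rewrite mem_undup mem_cat dt => /(_ isT) Id.
  rewrite -[k d](subrK (r * (if d \in s then c d else 0))).
  by apply: is_idealD => //; apply: is_idealMr.
Qed.

End UlrichIdeals.

(** * From I = b c A to the Ulrich ideal (b) + I *)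

Section UlrichCriterion.
Variable R : comNzRingType.
Implicit Types (I J N B G m : set R) (s : seq R) (a b c t x y : R).

Lemma ulrich_at_sub m b I : ulrich_at m b I -> I `<=` m.
Proof. by move=> [_ _ <- _ _] x Ix; exists 1. Qed.

(** Adding b to a basis of I / (b) gives a basis of I / I^2.  In a relation
    modulo I^2 = b I, reduction modulo (b) first puts the coefficients of the
    old basis in I; their terms then lie in I^2, and cancelling b puts the
    coefficient of b in I too. *)
Lemma ulrich_at_ulrich m b I :
  is_maximal m -> krull_dim R 1 -> ulrich_at m b I -> ulrich m I.
Proof.
move=> mmax hdim [idI I1 radI stabI [nIb [B [BI spanB indB]]]].
have [Ib reg_b IIb] := stabI.
have E x := ideal_exp2_stable x idI stabI.
have bI : ideal_gen [set b] `<=` I by apply: ideal_gen_min => // _ ->.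
have idb := ideal_gen_is_ideal [set b].
have set_b : [set` [:: b]] = [set b].
  by apply/seteqP; split=> x /=; rewrite inE => /eqP.
split; first exact: radical_maximal_primary.
have E2 : ideal_exp I 2 = ideal_mul (ideal_gen [set b]) I.
  by apply/seteqP; split=> x; rewrite ideal_mul_genl// E.
exists b; split=> //.
- split.
    exists [:: b]; rewrite set_b; split=> //; apply: radical_maximal_primary => //.
      by move=> /bI.
    apply/seteqP; split=> x; first by rewrite -radI => -[k /bI xk]; exists k.
    rewrite -radI => -[k xk]; exists (k + k)%N; rewrite exprD.
    have [z Iz ->] := IIb _ _ xk xk.
    by apply/ideal_gen1P; exists z; rewrite mulrC.
  by split=> //; exists 1%N.
- by move=> Ieq; apply: nIb; rewrite -Ieq.
have bB : ~ B b.
  move=> Bb; apply: I1; apply: (independent_coef indB Bb).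
  by apply/ideal_gen1P; exists 1.
exists [set d | d = b \/ B d]; split=> [d [->|/BI]//|x Ix|s c us sB].
- apply/spans_moduloP; set B1 := [set d | _].
  have [y yB /ideal_gen1P[r Er]] := (spans_moduloP _ _ _).1 (spanB x Ix).
  exists x; last by rewrite subrr E; exists 0; [case: idI|rewrite mulr0].
  rewrite -[x](subrK y) Er; apply: (is_idealD (ideal_gen_is_ideal B1)).
    by apply: (is_idealMl _ (ideal_gen_is_ideal B1)); apply: sub_ideal_gen; left.
  apply: (ideal_gen_min (ideal_gen_is_ideal B1)) yB => d Bd.
  by apply: sub_ideal_gen; right.
- pose r := if b \in s then c b else 0.
  pose s' := [seq d <- s | d != b].
  have -> : \sum_(d <- s) c d * d = r * b + \sum_(d <- s') c d * d.
    rewrite /r /s' big_filter; case: ifP => bs; first by rewrite (bigD1_seq b).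
    rewrite mul0r add0r [LHS]big_seq [RHS]big_seq_cond; apply: eq_bigl => d.
    apply/idP/idP => [ds|/andP[]//].
    by rewrite ds /=; apply: contraFneq bs => <-.
  move=> /E[z Iz Ez].
  have s'I d : d \in s' -> I (c d).
    apply: indB; first exact: filter_uniq.
      by move=> e /=; rewrite mem_filter => /andP[/eqP eb /sB[]].
    apply/ideal_gen1P; exists (z - r); apply: (addrI (r * b)); rewrite Ez; ring.
  have Ir : I r.
    have /E[w Iw Ew] : ideal_exp I 2 (\sum_(d <- s') c d * d).
      apply: (is_ideal_sum (ideal_gen_is_ideal _)) => d ds' _.
      apply: mem_ideal_mul; first exact: s'I.
      move: ds'; rewrite mem_filter => /andP[/eqP db /sB[//|]].
      exact: BI.
    have -> : r = z - w.
      by apply: reg_b; rewrite /= mulrBr -Ew -Ez; ring.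
    exact: is_idealB.
  move=> d ds; have [db|db] := eqVneq d b; last first.
    by apply: s'I; rewrite mem_filter db.
  by rewrite db; move: Ir; rewrite /r -db ds.
Qed.

(** The case of one factorization I = b c A, computed inside R: with
    J = (b) + I, any basis of I / (bc) over R / I is a basis of J / (b) over
    R / J. *)
Lemma ulrich_at_add m b c I : m b -> is_ideal m ->
  ulrich_at m (b * c) I -> ulrich_at m b (ideal_add (ideal_gen [set b]) I).
Proof.
move=> mb idm ulI; have Im := ulrich_at_sub ulI.
have [idI I1 radI stabI [nIbc [B [BI spanB indB]]]] := ulI.
have [Ibc reg_bc IIbc] := stabI.
have E x := ideal_exp2_stable x idI stabI.
set J := ideal_add _ _.
have idb := ideal_gen_is_ideal [set b].
have idJ : is_ideal J by apply: ideal_add_is_ideal.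
have bJ : J b by apply: mem_ideal_add.
have IJ : I `<=` J by apply: sub_ideal_add.
have Jm : J `<=` m by apply: ideal_add_min.
have radm x k : m (x ^+ k) -> m x.
  by rewrite -radI => -[l]; rewrite -exprM; exists (k * l)%N.
have m1 : ~ m 1 by rewrite -radI => -[k]; rewrite expr1n.
(* Expand c k on the basis, with coefficients e: multiplying by b gives a
   relation modulo (bc), so b e \in I and the terms b e d lie in I^2 = bc I;
   then bc can be cancelled from b (c k). *)
have JP k : I (c * k) -> J k.
  move=> Ick.
  have [_ /ideal_gen_combP[s [e [us sB ->]]] /ideal_gen1P[u Eu]] :=
    (spans_moduloP _ _ _).1 (spanB _ Ick).
  have {}Eu : \sum_(d <- s) e d * d = c * k - u * (b * c) by rewrite -Eu subKr.
  have be d : d \in s -> I (b * e d).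
    apply: (indB s (fun d => b * e d)) => //.
    apply/ideal_gen1P; exists (k - u * b).
    under eq_bigr do rewrite -mulrA.
    by rewrite -big_distrr /= Eu; ring.
  have /E[z Iz Ez] : ideal_exp I 2 (b * \sum_(d <- s) e d * d).
    rewrite big_distrr /=; apply: (is_ideal_sum (ideal_gen_is_ideal _)) => d ds _.
    by rewrite mulrA; apply: mem_ideal_mul; [exact: be|exact/BI/sB].
  apply/ideal_add_gen1P; exists u, z => //; apply: reg_bc => /=.
  by rewrite mulrDr -Ez Eu; ring.
have indJ s e : uniq s -> [set` s] `<=` B ->
    ideal_gen [set b] (\sum_(d <- s) e d * d) -> forall d, d \in s -> J (e d).
  move=> us sB /ideal_gen1P[r Er] d ds; apply: JP.
  apply: (indB s (fun d => c * e d)) ds => //.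
  under eq_bigr do rewrite -mulrA.
  by rewrite -big_distrr /= Er; apply/ideal_gen1P; exists r; ring.
split=> //.
- by move=> /Jm.
- apply/seteqP; split=> x; first by move=> [k /Jm/radm].
  by rewrite -radI => -[k /IJ xk]; exists k.
- split=> //; first exact: lreg_factor reg_bc.
  move=> _ _ /ideal_add_gen1P[r [y Iy ->]] /ideal_add_gen1P[r' [y' Iy' ->]].
  have [z Iz Ez] := IIbc _ _ Iy Iy'.
  exists (r * r' * b + (r * y' + r' * y + c * z)).
    apply/ideal_add_gen1P; exists (r * r'), (r * y' + r' * y + c * z) => //.
    by do 2?[apply: is_idealD => //]; apply: is_idealMl.
  have -> : (r * b + y) * (r' * b + y') =
    b * (r * r' * b + (r * y' + r' * y)) + y * y' by ring.
  by rewrite Ez; ring.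
split.
  have [d Bd] := spanning_nonempty spanB nIbc.
  move=> Jb; apply: m1; apply: Jm; apply: (independent_coef indJ Bd).
  by rewrite mul1r; apply: Jb; apply: IJ; apply: BI.
exists B; split=> //; first exact: subset_trans IJ.
move=> _ /ideal_add_gen1P[r [x Ix ->]]; apply/spans_moduloP.
have [y yB /ideal_gen1P[u Eu]] := (spans_moduloP _ _ _).1 (spanB _ Ix).
exists y => //; apply/ideal_gen1P; exists (r + u * c).
by rewrite -addrA Eu; ring.
Qed.

(** If b \in I, then b I lies in bc I, so that a basis element d is c z with
    z \in I; expanding z on the basis makes the coefficient 1 of d congruent
    modulo I to a multiple of c, hence an element of m. *)
Lemma ulrich_at_not_mem m b c I :
  is_ideal m -> m c -> ulrich_at m (b * c) I -> ~ I b.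
Proof.
move=> idm mc ulI Ib; have Im := ulrich_at_sub ulI.
have [idI I1 radI [Ibc reg_bc IIbc] [nIbc [B [BI spanB indB]]]] := ulI.
have m1 : ~ m 1 by rewrite -radI => -[k]; rewrite expr1n.
have [d Bd] := spanning_nonempty spanB nIbc.
have [z Iz Ez] := IIbc _ _ Ib (BI _ Bd).
have dz : d = c * z by apply: (lreg_factor reg_bc); rewrite /= Ez mulrA.
have [_ /ideal_gen_combP[s [e [us sB ->]]] /ideal_gen1P[u Eu]] :=
  (spans_moduloP _ _ _).1 (spanB _ Iz).
have tB : [set` undup (d :: s)] `<=` B.
  move=> f fds; have : f \in undup (d :: s) := fds.
  by rewrite mem_undup inE => /predU1P[->|/sB].
apply: m1; set k := fun f => (if f \in [:: d] then 1 else 0) -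
  c * (if f \in s then e f else 0).
have : I (k d).
  apply: (indB _ k (undup_uniq (d :: s)) tB); last by rewrite mem_undup mem_head.
  under eq_bigr do rewrite mulrBl -mulrA.
  rewrite sumrB -big_distrr /= -!(@sum_extend _ _ (undup (d :: s)));
    rewrite ?undup_uniq//; last first.
  - by move=> f fd; rewrite mem_undup inE; move: fd; rewrite inE => ->.
  - by move=> f fs; rewrite mem_undup inE fs orbT.
  rewrite big_seq1 mul1r; apply/ideal_gen1P; exists (c * u).
  by rewrite {1}dz -mulrBr Eu; ring.
rewrite /k mem_head => /Im; set h := c * _ => mh.
rewrite -[1](subrK h); apply: is_idealD => //; exact: is_idealMr.
Qed.

End UlrichCriterion.

(** * The ring I : I *)

Section EndomorphismRing.
Variable R : comNzRingType.
Implicit Types (I J m : set R) (a b c x y : R).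
Local Notation frac := (@to_total_frac R).
Implicit Types (u v w z : total_frac R).

Lemma frac_mulIf a u v : GRing.lreg a -> u * frac a = v * frac a -> u = v.
Proof.
move=> /to_total_frac_unit[t ta] uv.
by rewrite -[u]mulr1 -[v]mulr1 -ta [t * _]mulrC !mulrA uv.
Qed.

Lemma self_colonP I z :
  self_colon I z <-> forall x, I x -> exists2 y, I y & z * frac x = frac y.
Proof.
split=> [zI x Ix|zI _ [x Ix <-]]; last by have [y Iy ->] := zI x Ix; exists y.
by have [|y Iy <-] := zI (frac x); [exists x|exists y].
Qed.

Lemma self_colon_frac I a : is_ideal I -> self_colon I (frac a).
Proof.
move=> idI; apply/self_colonP => x Ix; exists (a * x); first exact: is_idealMl.
by rewrite rmorphM.
Qed.

Lemma self_colon1 I : self_colon I 1.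
Proof. by move=> x Ix; rewrite mul1r. Qed.

Lemma self_colonM I u v : self_colon I u -> self_colon I v -> self_colon I (u * v).
Proof. by move=> uI vI x /vI/uI; rewrite mulrA. Qed.

Lemma self_colonD I u v : is_ideal I ->
  self_colon I u -> self_colon I v -> self_colon I (u + v).
Proof.
move=> idI /self_colonP uI /self_colonP vI; apply/self_colonP => x Ix.
have [y Iy Ey] := uI x Ix; have [y' Iy' Ey'] := vI x Ix.
by exists (y + y'); [apply: is_idealD|rewrite mulrDl rmorphD Ey Ey'].
Qed.

Lemma self_colonN I u : is_ideal I -> self_colon I u -> self_colon I (- u).
Proof.
move=> idI uI; rewrite -mulN1r; apply: self_colonM => //.
by rewrite -(rmorph1 frac) -rmorphN; apply: self_colon_frac.
Qed.

Lemma self_colonX I u n : self_colon I u -> self_colon I (u ^+ n).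
Proof.
move=> uI; elim: n => [|n IHn]; first by rewrite expr0; apply: self_colon1.
by rewrite exprS; apply: self_colonM.
Qed.

Lemma self_colon_sum I n (F : 'I_n -> total_frac R) : is_ideal I ->
  (forall i, self_colon I (F i)) -> self_colon I (\sum_i F i).
Proof.
move=> idI FI; apply: big_ind => // [|u v].
  by rewrite -(rmorph0 frac); apply: self_colon_frac.
exact: self_colonD.
Qed.

(** Multiplication by a identifies I : I with I, so that statements about
    I : I can be tested on ideals of R. *)
Lemma self_colon_stableP a I z : is_ideal I -> stable_at a I ->
  self_colon I z <-> exists2 y, I y & z * frac a = frac y.
Proof.
move=> idI [Ia reg_a IIa]; split=> [/self_colonP/(_ a Ia)//|[y Iy zy]].
apply/self_colonP => x Ix; have [t It Et] := IIa y x Iy Ix.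
exists t => //; apply: (frac_mulIf reg_a).
by rewrite mulrAC zy -!rmorphM Et mulrC.
Qed.

Lemma stable_image a I : is_ideal I -> stable_at a I ->
  frac @` I = [set frac a * z | z in self_colon I].
Proof.
move=> idI stabI; have [Ia reg_a _] := stabI.
apply/seteqP.
split=> [_ [x Ix <-]|_ [z /self_colonP/(_ a Ia)[y Iy zy] <-]]; last first.
  by exists y; rewrite // -zy mulrC.
have [t ta] := to_total_frac_unit reg_a.
exists (t * frac x); last by rewrite mulrA [_ * t]mulrC ta mul1r.
apply/(self_colon_stableP _ idI stabI); exists x => //.
by rewrite mulrAC ta mul1r.
Qed.

(** The regularity of b is inherited from any other generator a, because a^2 is
    a multiple of b. *)
Lemma image_stable a b I : is_ideal I -> stable_at a I ->
  frac @` I = [set frac b * z | z in self_colon I] -> stable_at b I.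
Proof.
move=> idI [Ia reg_a IIa] EI.
have Ib : I b.
  have : (frac @` I) (frac b).
    by rewrite EI; exists 1; [apply: self_colon1|rewrite mulr1].
  by case=> x Ix /to_total_frac_inj <-.
have IIb x y : I x -> I y -> exists2 z, I z & x * y = b * z.
  move=> Ix Iy; have : (frac @` I) (frac x) by exists x.
  rewrite EI => -[u /self_colonP/(_ y Iy)[z Iz uz] xu]; exists z => //.
  by apply: to_total_frac_inj; rewrite !rmorphM /= -xu -uz mulrA.
split=> //; have [z _ aa] := IIb a a Ia Ia.
by apply: (@lreg_factor _ _ z); rewrite -aa; apply: GRing.lregM.
Qed.

End EndomorphismRing.

(** * Units of I : I *)

Section Units.
Variables (R : comNzRingType) (m I : set R) (a : R).
Hypotheses (loc : local_ring m) (idI : is_ideal I) (I1 : ~ I 1).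
Hypotheses (radI : radical I = m) (stabI : stable_at a I).
Local Notation frac := (@to_total_frac R).
Local Notation A := (self_colon I).
Implicit Types (u v w z : total_frac R).

(** This is the ideal mA of A, written as a^-1 (mI) so that m I can be handled
    as an ideal of R. *)
Definition max_ext z := exists2 x, ideal_mul m I x & z * frac a = frac x.

Let idmI : is_ideal (ideal_mul m I) := ideal_gen_is_ideal _.

Let mI_sub : ideal_mul m I `<=` I.
Proof. by apply: ideal_mul_min => // x y _; apply: is_idealMl. Qed.

Let Im : I `<=` m.
Proof. by move=> x Ix; rewrite -radI; exists 1. Qed.

Let idm : is_ideal m. Proof. by have [_ []] := loc. Qed.

Lemma max_ext_self_colon z : max_ext z -> A z.
Proof.
by move=> [x /mI_sub Ix zx]; apply/(self_colon_stableP _ idI stabI); exists x.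
Qed.

Lemma max_extD u v : max_ext u -> max_ext v -> max_ext (u + v).
Proof.
move=> [x mIx ux] [y mIy vy]; exists (x + y); first exact: (is_idealD idmI).
by rewrite mulrDl ux vy rmorphD.
Qed.

Lemma max_extMl u z : A u -> max_ext z -> max_ext (u * z).
Proof.
move=> /self_colonP Au [x mIx zx]; rewrite /max_ext -mulrA zx.
pose K := [set x | exists2 y, ideal_mul m I y & u * frac x = frac y].
apply: (@ideal_mul_min _ m I K) mIx => [|t y mt Iy].
  split.
  - by exists 0; rewrite ?rmorph0 ?mulr0//; case: idmI.
  - move=> y z' [y' my' Ey] [z'' mz'' Ez].
    exists (y' + z''); first exact: (is_idealD idmI).
    by rewrite !rmorphD mulrDr Ey Ez.
  - move=> c y [y' my' Ey]; exists (c * y'); first exact: (is_idealMl _ idmI).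
    by rewrite !rmorphM mulrCA Ey.
have [y' Iy' Ey'] := Au y Iy; exists (t * y'); first exact: mem_ideal_mul.
by rewrite !rmorphM mulrCA Ey'.
Qed.

Lemma max_ext_frac x : m x -> max_ext (frac x).
Proof.
move=> mx; exists (x * a); last by rewrite rmorphM.
by apply: mem_ideal_mul => //; case: stabI.
Qed.

(* The radical of the ideal I of A, which turns out to contain mA. *)
Let ext_nil z := A z /\ exists k, (frac @` I) (z ^+ k).

Let extM u z : A u -> (frac @` I) z -> (frac @` I) (u * z).
Proof. by move=> Au [x Ix <-]; apply: Au; exists x. Qed.

Let ext_nilD u v : ext_nil u -> ext_nil v -> ext_nil (u + v).
Proof.
move=> [Au [k uk]] [Av [l vl]]; split; first exact: self_colonD.
exists (k + l)%N; rewrite exprDn.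
apply: (big_ind (frac @` I)) => [|_ _ [x Ix <-] [y Iy <-]|i _].
- by exists 0; rewrite ?rmorph0//; case: idI.
- by exists (x + y); [apply: is_idealD|rewrite rmorphD].
rewrite -mulr_natl -(rmorph_nat frac); apply: extM; first exact: self_colon_frac.
have [li|il] := leqP l i.
  rewrite -(subnKC li) exprD [v ^+ l * _]mulrC mulrA; apply: extM => //.
  by apply: self_colonM; apply: self_colonX.
have -> : (k + l - i = k + (l - i))%N by rewrite addnBA // ltnW.
rewrite exprD -mulrA mulrC; apply: extM => //.
by apply: self_colonM; apply: self_colonX.
Qed.

Lemma max_ext_nilpotent z : max_ext z -> exists k, (frac @` I) (z ^+ k).
Proof.
suff sub x : ideal_mul m I x -> forall z, z * frac a = frac x -> ext_nil z.
  by move=> [x mIx zx]; have [] := sub x mIx z zx.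
have [Ia reg_a _] := stabI; have [t ta] := to_total_frac_unit reg_a.
have tK y u : u * frac a = frac y <-> u = t * frac y.
  split=> [<-|->]; first by rewrite mulrCA ta mulr1.
  by rewrite mulrAC ta mul1r.
pose K := [set x | ext_nil (t * frac x)].
move=> mIx u /tK->; apply: (@ideal_mul_min _ m I K) mIx => [|s y ms Iy].
  split.
  - rewrite /K /= rmorph0 mulr0 -(rmorph0 frac); split; first exact: self_colon_frac.
    by exists 1; rewrite expr1; exists 0 => //; case: idI.
  - by move=> y y' Ky Ky'; rewrite /K /= rmorphD mulrDr; apply: ext_nilD.
  - move=> c y [Ay [k yk]]; rewrite /K /= rmorphM mulrCA; split.
      by apply: self_colonM => //; apply: self_colon_frac.
    exists k; rewrite exprMn; apply: extM => //.
    by rewrite -rmorphXn; apply: self_colon_frac.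
rewrite /K /= rmorphM mulrCA.
have Ay : A (t * frac y).
  by apply/(self_colon_stableP _ idI stabI); exists y => //; apply/tK.
split; first by apply: self_colonM => //; apply: self_colon_frac.
move: ms; rewrite -radI => -[k sk]; exists k; rewrite exprMn mulrC.
apply: extM; first exact: self_colonX.
by exists (s ^+ k); rewrite ?rmorphXn.
Qed.

(** A stand-in for the inclusion of mA in the Jacobson radical of A: some power
    z^k is an element i of I, 1 - i is a unit of R, and 1 - z divides 1 - z^k. *)
Lemma unit_of_one_sub_max_ext z : max_ext z -> exists2 u, A u & (1 - z) * u = 1.
Proof.
move=> Mz; have Az := max_ext_self_colon Mz.
have [k [i Ii Ei]] := max_ext_nilpotent Mz.
have [|i' ii'] := @local_unit _ m (1 - i) loc.
  have [_ [_ m1 _] _] := loc.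
  by move=> mi; apply: m1; rewrite -(subrK i 1); apply: is_idealD => //; apply: Im.
exists ((\sum_(j < k) z ^+ j) * frac i').
  apply: self_colonM; last exact: self_colon_frac.
  by apply: self_colon_sum => // j; apply: self_colonX.
rewrite mulrA.
have -> : (1 - z) * (\sum_(j < k) z ^+ j) = 1 - z ^+ k.
  by rewrite -[RHS]opprB subrX1 -mulNr opprB.
by rewrite -Ei -(rmorph1 frac) -rmorphB -rmorphM ii' rmorph1.
Qed.

(** For w in A this is R + R w + .. + R w^(n-1) + mA, built by Horner's scheme, so
    that w^n belongs to it exactly when w satisfies modulo mA a monic equation of
    degree n with coefficients in R. *)
Definition power_span w n : set (total_frac R) :=
  iter n (fun T => [set z | exists r u v,
    [/\ T u, max_ext v & z = frac r + w * u + v]]) max_ext.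

Section PowerSpan.
Variable w : total_frac R.
Hypothesis Aw : A w.
Let S := power_span w.

Let max_ext0 : max_ext 0.
Proof. by exists 0; rewrite ?mul0r ?rmorph0//; case: idmI. Qed.

Let span_self_colon n z : S n z -> A z.
Proof.
elim: n z => [|n IHn] z; first exact: max_ext_self_colon.
move=> [r [u [v [/IHn Au /max_ext_self_colon Av ->]]]].
apply: self_colonD => //; apply: self_colonD => //; last exact: self_colonM.
exact: self_colon_frac.
Qed.

Let spanD n u v : S n u -> S n v -> S n (u + v).
Proof.
elim: n u v => [|n IHn] u v; first exact: max_extD.
move=> [r [u1 [v1 [Su1 Mv1 ->]]]] [r' [u2 [v2 [Su2 Mv2 ->]]]].
exists (r + r'), (u1 + u2), (v1 + v2); split; [exact: IHn|exact: max_extD|].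
by rewrite rmorphD; ring.
Qed.

Let spanM n c u : S n u -> S n (frac c * u).
Proof.
elim: n u => [|n IHn] u; first by apply: max_extMl; apply: self_colon_frac.
move=> [r [u1 [v1 [Su1 Mv1 ->]]]].
exists (c * r), (frac c * u1), (frac c * v1); split; first exact: IHn.
  by apply: max_extMl => //; apply: self_colon_frac.
by rewrite rmorphM; ring.
Qed.

Let span_max_ext n z : max_ext z -> S n z.
Proof.
elim: n z => [//|n IHn] z Mz; exists 0, 0, z; split=> //; first exact: IHn.
by rewrite rmorph0; ring.
Qed.

Let span_mono n k z : (n <= k)%N -> S n z -> S k z.
Proof.
move=> nk; have {nk} [j ->] : exists j, k = (n + j)%N.
  by exists (k - n)%N; rewrite subnKC.
elim: n z => [|n IHn] z; first exact: span_max_ext.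
by move=> [r [u [v [/IHn Su Mv ->]]]]; exists r, u, v.
Qed.

Let span_pow n : S n.+1 (w ^+ n).
Proof.
elim: n => [|n IHn].
  by exists 1, 0, 0; split=> //; rewrite rmorph1 expr0; ring.
by exists 0, (w ^+ n), 0; split=> //; rewrite rmorph0 exprS; ring.
Qed.

(* Integrality of w: multiplication by a carries the increasing sequence
   S n into ideals of R, where it is stationary. *)
Let span_stationary : exists n, S n (w ^+ n).
Proof.
have [noethR _ _] := loc; have [Ia reg_a _] := stabI.
pose U n := [set x | exists2 z, S n z & z * frac a = frac x].
have idU n : is_ideal (U n).
  split.
  - by exists 0; [exact: span_max_ext|rewrite mul0r rmorph0].
  - move=> x y [z Sz zx] [z' Sz' zy]; exists (z + z'); first exact: spanD.
    by rewrite mulrDl zx zy rmorphD.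
  - move=> c x [z Sz zx]; exists (frac c * z); first exact: spanM.
    by rewrite -mulrA zx rmorphM.
have U_mono n k x : (n <= k)%N -> U n x -> U k x.
  by move=> nk [z Sz zx]; exists z => //; apply: span_mono Sz.
have idV : is_ideal [set x | exists n, U n x].
  split.
  - by exists 0; case: (idU 0).
  - move=> x y [n Ux] [k Uy]; exists (maxn n k); apply: is_idealD => //.
      by apply: U_mono Ux; rewrite leq_maxl.
    by apply: U_mono Uy; rewrite leq_maxr.
  - by move=> c x [n Ux]; exists n; apply: is_idealMl.
have [s Es] := noethR _ idV.
have [n sU] : exists n, forall x, x \in s -> U n x.
  have sV x : x \in s -> exists n, U n x.
    move=> xs; suff : [set x | exists n, U n x] x by [].
    by rewrite Es; apply: sub_ideal_gen.
  elim: s {Es} sV => [|x s IHs] sV; first by exists 0.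
  have [|n sU] := IHs; first by move=> y ys; apply: sV; rewrite inE ys orbT.
  have [k Ux] := sV x (mem_head _ _).
  exists (maxn n k) => y; rewrite inE => /predU1P[->|/sU].
    by apply: U_mono Ux; rewrite leq_maxr.
  by apply: U_mono; rewrite leq_maxl.
exists n.
have [x Ix Ex] : exists2 x, I x & w ^+ n * frac a = frac x.
  by apply/(self_colon_stableP _ idI stabI); apply: self_colonX.
have : U n x.
  apply: (ideal_gen_min (idU n) sU); rewrite -Es.
  by exists n.+1, (w ^+ n).
by move=> [z Sz zx]; rewrite (frac_mulIf reg_a (etrans Ex (esym zx))).
Qed.

(** Take a monic equation w^n = r + w s + z of least degree modulo mA.  Then
    v = w^(n-1) - s is outside mA by minimality, whereas w v = r + z; if r were in
    m, then v would be in mA by regularity of w.  So r is a unit of R, and w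
    divides a unit of A. *)
Lemma unit_of_regular_mod_max_ext :
  (forall v, A v -> max_ext (w * v) -> max_ext v) ->
  exists2 u, A u & w * u = 1.
Proof.
move=> reg_w.
have ex_n : exists n, `[< S n (w ^+ n) >].
  by have [n Sn] := span_stationary; exists n; apply/asboolP.
case: (ex_minnP ex_n) => [[|n]] /asboolP Sn n_min.
  have [k] := max_ext_nilpotent Sn; rewrite expr0 expr1n -(rmorph1 frac).
  by case=> x Ix /to_total_frac_inj Ex; case: I1; rewrite -Ex.
have [r [s [z [Ss Mz Ew]]]] := Sn.
have As := span_self_colon Ss.
pose v := w ^+ n - s.
have Av : A v.
  by apply: self_colonD => //; [apply: self_colonX|apply: self_colonN].
have wv : w * v = frac r + z.
  by rewrite /v mulrBr -exprS Ew; ring.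
have [|r' rr'] := @local_unit _ m r loc.
  move=> mr; have : max_ext v.
    by apply: reg_w => //; rewrite wv; apply: max_extD => //; apply: max_ext_frac.
  move=> Mv; have : S n (w ^+ n).
    by rewrite -(subrK s (w ^+ n)); apply: spanD => //; apply: span_max_ext.
  by move=> /asboolP/n_min; rewrite ltnn.
have [|u Au Eu] := @unit_of_one_sub_max_ext (- frac r' * z).
  apply: max_extMl => //; rewrite -rmorphN; exact: self_colon_frac.
exists (v * frac r' * u).
  by do 2?[apply: self_colonM => //]; apply: self_colon_frac.
rewrite -Eu !mulrA wv; congr (_ * _).
by rewrite mulrDl -rmorphM rr' rmorph1; ring.
Qed.

End PowerSpan.
End Units.

(** * Two nested Ulrich ideals *)

Section Nested.
Variable R : comNzRingType.
Implicit Types (I J L m : set R) (a b c t x y z g : R).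
Local Notation frac := (@to_total_frac R).

(** In terms of A = I : I: the conductor R : A is I, since A / R is free and
    nonzero over R / I. *)
Lemma ulrich_at_colon m a I z : ulrich_at m a I ->
  (forall x, I x -> ideal_gen [set a] (z * x)) -> I z.
Proof.
move=> [_ _ _ _ [nIa [B [BI spanB indB]]]] zI.
have [d Bd] := spanning_nonempty spanB nIa.
by apply: (independent_coef indB Bd); apply: zI; apply: BI.
Qed.

(** In terms of A = I : I: the part of the free module A / R killed by J is
    (L A + R) / R with L = I : J, as one sees on coordinates. *)
Lemma ulrich_at_coordinates m a I (J : set R) x : ulrich_at m a I -> I x ->
  (forall g, J g -> ideal_gen [set a] (g * x)) ->
  exists r, exists2 y,
    ideal_mul [set l | forall g, J g -> I (g * l)] I y & x = r * a + y.
Proof.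
move=> [idI _ _ _ [_ [B [BI spanB indB]]]] Ix Jx.
have [_ /ideal_gen_combP[s [e [us sB ->]]] /ideal_gen1P[r Er]] :=
  (spans_moduloP _ _ _).1 (spanB _ Ix).
exists r, (\sum_(d <- s) e d * d); last by rewrite -Er subrK.
apply: (is_ideal_sum (ideal_gen_is_ideal _)) => d ds _.
apply: mem_ideal_mul; last exact/BI/sB.
move=> g Jg; apply: (indB s (fun d => g * e d)) ds => //.
under eq_bigr do rewrite -mulrA.
rewrite -big_distrr /= -[S in g * S](subKr x) Er.
have /ideal_gen1P[k Ek] := Jx _ Jg.
by apply/ideal_gen1P; exists (k - g * r); rewrite mulrBr Ek; ring.
Qed.

(** In terms of A = I : I: if c \in R lies outside I and c v \in I for some
    v \in A, then v \in mA, since A / I is free over R / I on 1 and a basis of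
    A / R. *)
Lemma ulrich_at_residue m a I c x : local_ring m -> ulrich_at m a I ->
  I x -> ~ I c -> (exists2 z, I z & c * x = a * z) -> ideal_mul m I x.
Proof.
move=> loc [idI _ radI stabI [_ [B [BI spanB indB]]]] Ix Ic [z Iz Ez].
have E y := ideal_exp2_stable y idI stabI.
have [Ia reg_a _] := stabI.
have unit_m e : I (c * e) -> m e.
  move=> Ice; apply: contrapT => /(local_unit loc)[u eu]; apply: Ic.
  by rewrite -[c]mulr1 -eu mulrA; apply: is_idealMr.
have [_ /ideal_gen_combP[s [e [us sB ->]]] /ideal_gen1P[r Er]] :=
  (spans_moduloP _ _ _).1 (spanB _ Ix).
have {}Er : x = r * a + \sum_(d <- s) e d * d by rewrite -Er subrK.
have ce d : d \in s -> I (c * e d).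
  apply: (indB s (fun d => c * e d)) => //.
  under eq_bigr do rewrite -mulrA.
  rewrite -big_distrr /=; apply/ideal_gen1P; exists (z - c * r).
  apply: (addrI (c * (r * a))); rewrite -mulrDr -Er Ez; ring.
have /E[w Iw Ew] : ideal_exp I 2 (c * \sum_(d <- s) e d * d).
  rewrite big_distrr /=; apply: (is_ideal_sum (ideal_gen_is_ideal _)) => d ds _.
  by rewrite mulrA; apply: mem_ideal_mul; [exact: ce|exact/BI/sB].
rewrite Er; apply: (is_idealD (ideal_gen_is_ideal _)).
  apply: mem_ideal_mul => //; apply: unit_m.
  suff -> : c * r = z - w by apply: is_idealB.
  by apply: reg_a; rewrite /= mulrBr -Ew -Ez Er; ring.
apply: (is_ideal_sum (ideal_gen_is_ideal _)) => d ds _.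
by apply: mem_ideal_mul; [exact/unit_m/ce|exact/BI/sB].
Qed.

(** One step of the chain.  In the proof, y \in J stands for the element y / b of
    B = J : J, and d = a / b is never named. *)
Lemma ulrich_at_factor m a b I J : local_ring m ->
  ulrich_at m a I -> ulrich_at m b J -> I `<` J ->
  exists2 c, m c & stable_at (b * c) I /\ J = ideal_add (ideal_gen [set b]) I.
Proof.
move=> loc ulI ulJ [IJ nJI]; have [noethR [idm _ _] _] := loc.
have [idI I1 radI stabI _] := ulI; have [Ia reg_a IIa] := stabI.
have [idJ J1 radJ [Jb reg_b JJb] _] := ulJ.
pose L := [set l | forall g, J g -> I (g * l)].
(* B is contained in A. *)
have JI_a y : J y -> exists2 z, I z & y * a = b * z.
  move=> Jy; have [z Jz Ez] := JJb _ _ Jy (IJ _ Ia); exists z => //.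
  apply: (ulrich_at_colon ulI) => x Ix.
  have [z' _ Ez'] := JJb _ _ Jy (IJ _ Ix).
  apply/ideal_gen1P; exists z'; apply: reg_b => /=.
  by rewrite mulrA -Ez mulrAC Ez'; ring.
(* B I is contained in I. *)
have JI_b y x : J y -> I x -> exists2 z, I z & y * x = b * z.
  move=> /JI_a[y' Iy' Ey'] Ix; have [z Iz Ez] := IIa _ _ Iy' Ix.
  by exists z => //; apply: reg_a; rewrite /= mulrA [a * y]mulrC Ey' -mulrA Ez; ring.
have LI_a k : (forall l, L l -> I (k * l)) ->
    forall x, ideal_mul L I x -> exists2 z, I z & k * x = a * z.
  move=> kL; apply: (ideal_mul_min (is_ideal_colon k (is_ideal_scale a idI))).
  by move=> l x /kL Ikl Ix /=; rewrite mulrA; apply: IIa.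
(* B = R + L A, with L A = a^-1 (L I). *)
have J_decomp y : J y ->
    exists r, exists2 x, ideal_mul L I x & y * a = b * (r * a + x).
  move=> Jy; have [z Iz Ez] := JI_a y Jy.
  have [|r [x LIx Ex]] := @ulrich_at_coordinates m a I J z ulI Iz.
    move=> g Jg; have [h _ Eh] := JJb _ _ Jg Jy.
    apply/ideal_gen1P; exists h; apply: reg_b => /=.
    by rewrite mulrCA -Ez [LHS]mulrA Eh; ring.
  by exists r, x; rewrite // Ez Ex.
have EJ : J = ideal_add (ideal_gen [set b]) I.
  apply/seteqP; split=> [y Jy|]; last exact: ideal_add_min.
  have [r [x LIx Ex]] := J_decomp y Jy.
  have [l /(_ b Jb)//|z Iz Ez] := LI_a b _ x LIx.
  apply/ideal_add_gen1P; exists r, z => //; apply: reg_a => /=.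
  by rewrite mulrC Ex mulrDr Ez; ring.
have [t Jt mt] : exists2 t, ~ J t & forall x, m x -> J (x * t).
  have [|t] := @radical_socle _ J m 1 noethR idJ idm _ J1; first by rewrite radJ.
  by rewrite mulr1; exists t.
(* If t L were inside I, then t B would be inside R, and t in R : B = J. *)
have [c Lc Itc] : exists2 c, L c & ~ I (t * c).
  apply: contrapT => nc; apply: Jt; apply: (ulrich_at_colon ulJ) => y Jy.
  have tL l : L l -> I (t * l).
    by move=> Ll; apply: contrapT => Itl; apply: nc; exists l.
  have [r [x LIx Ex]] := J_decomp y Jy.
  have [z Iz Ez] := LI_a t tL x LIx.
  apply/ideal_gen1P; exists (t * r + z); apply: reg_a => /=.
  by rewrite mulrCA [a * y]mulrC Ex mulrCA mulrDr Ez; ring.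
have Ibc : I (b * c) by apply: Lc.
have mc : m c.
  apply: contrapT => /(local_unit loc)[c' cc']; apply: nJI => y /Lc Iyc.
  by rewrite -[y]mulr1 -cc' mulrA; apply: is_idealMr.
exists c => //; split=> //.
(* w is c / d. *)
have [q qa] := to_total_frac_unit reg_a.
pose w := q * frac (b * c).
have wa : w * frac a = frac (b * c) by rewrite /w mulrAC qa mul1r.
have wa_bc : w * frac a = frac b * frac c by rewrite wa rmorphM.
have Aw : self_colon I w by apply/(self_colon_stableP _ idI stabI); exists (b * c).
have [v|u /self_colonP Au wu] := unit_of_regular_mod_max_ext loc idI I1 radI stabI Aw.
  move=> /(self_colon_stableP _ idI stabI)[x Ix vx] [p mIp Ep].
  exists x => //; apply: (ulrich_at_residue (c := t * c) loc ulI) => //.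
  have Ebcx : b * c * x = a * p.
    apply: to_total_frac_inj; rewrite !rmorphM /= -Ep -vx -wa_bc.
    by ring.
  have [z Iz Ez] : exists2 z, I z & t * p = b * z.
    move: mIp; apply: (ideal_mul_min (is_ideal_colon t (is_ideal_scale b idI))).
    by move=> k y mk Iy /=; rewrite mulrA [t * k]mulrC; apply: JI_b => //; apply: mt.
  exists z => //; apply: reg_b => /=.
  have -> : b * (t * c * x) = t * (b * c * x) by ring.
  by rewrite Ebcx mulrCA Ez; ring.
have II_bc x y : I x -> I y -> exists2 z, I z & x * y = b * c * z.
  move=> Ix Iy; have [z Iz Ez] := IIa x y Ix Iy; have [z' Iz' Ez'] := Au z Iz.
  exists z' => //; apply: to_total_frac_inj.
  rewrite Ez !rmorphM /= -Ez' -wa_bc.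
  by rewrite -[LHS]mulr1 -wu; ring.
split=> //; have [z _ Ez] := II_bc a a Ia Ia.
by apply: (@lreg_factor _ _ z); rewrite -Ez; apply: GRing.lregM.
Qed.

End Nested.

(** * Chains of Ulrich ideals *)

Theorem theorem1p3 (R : comNzRingType) (m : set R)
    (hCM : cohen_macaulay m) (hdim : krull_dim R 1) :
  (forall (I : set R) (n : nat) (a : nat -> R),
     ulrich m I -> (2 <= n)%N ->
     (forall i, (1 <= i <= n)%N -> m (a i)) ->
     let A := self_colon I in
     to_total_frac @` I =
             [set to_total_frac (\prod_(1 <= j < n.+1) a j) * x | x in A] ->
     let I_ := fun i : nat =>
       ideal_add (ideal_gen [set \prod_(1 <= j < i.+1) a j]) I in
     [/\ forall i, (1 <= i <= n)%N -> ulrich m (I_ i),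
         I = I_ n
       & forall i, (1 <= i < n)%N -> I_ i.+1 `<` I_ i])
  /\
  (forall (n : nat) (I_ : nat -> set R),
     (2 <= n)%N ->
     (forall i, (1 <= i <= n)%N -> ulrich m (I_ i)) ->
     (forall i, (1 <= i < n)%N -> I_ i.+1 `<` I_ i) ->
     let I := I_ n in
     let A := self_colon I in
     exists a : nat -> R,
       [/\ forall i, (1 <= i <= n)%N -> m (a i),
           to_total_frac @` I =
             [set to_total_frac (\prod_(1 <= j < n.+1) a j) * x | x in A]
         & forall i, (1 <= i <= n.-1)%N ->
             I_ i = ideal_add (ideal_gen [set \prod_(1 <= j < i.+1) a j]) I]).
Proof.
have [loc _] := hCM; have [_ mmax _] := loc; have [idm m1 _] := mmax.
have mP k (f : nat -> R) i j : (i <= k < j)%N -> m (f k) ->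
    m (\prod_(i <= l < j) f l).
  move=> /andP[ik kj] mfk; rewrite (big_cat_nat ik (ltnW kj)) /=.
  rewrite [X in _ * X]big_ltn //.
  by apply: is_idealMl => //; apply: is_idealMr.
split=> [I n a ulI n2 ma A EI I_|n I_ n2 ulI_ I_lt I A].
- have [a0 stab0] := ulrich_stable hCM hdim ulI.
  have [[[idI _ _] _] _] := ulI.
  (* The product of all the a_j may serve as the generator of I over A. *)
  have stabI := image_stable idI stab0 EI.
  have ulI_at := ulrich_change_generator loc ulI stabI.
  have [Ib _ _] := stabI.
  have EIn : I = I_ n.
    by apply/seteqP; split; [exact: sub_ideal_add|exact: ideal_add_min].
  have mb i : (1 <= i <= n)%N -> m (\prod_(1 <= j < i.+1) a j).
    by move=> /andP[i1 iN]; apply: (mP 1%N) => //; apply: ma; exact: leq_trans iN.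
  have ulI_split i : (1 <= i < n)%N ->
      ulrich_at m (\prod_(1 <= j < i.+1) a j * \prod_(i.+1 <= j < n.+1) a j) I.
    move=> /andP[i1 iN].
    have <- : \prod_(1 <= j < n.+1) a j =
        \prod_(1 <= j < i.+1) a j * \prod_(i.+1 <= j < n.+1) a j.
      by apply: big_cat_nat; rewrite // ltnS ltnW.
    exact: ulI_at.
  split=> // i /andP[i1 iN].
    move: iN; rewrite leq_eqVlt => /predU1P[->|iN]; first by rewrite -EIn.
    apply: (ulrich_at_ulrich mmax hdim); apply: ulrich_at_add => //.
      by apply: mb; rewrite i1 ltnW.
    by apply: ulI_split; rewrite i1.
  have mi1 : m (a i.+1) by apply: ma; rewrite iN.
  have Ebi : \prod_(1 <= j < i.+2) a j = \prod_(1 <= j < i.+1) a j * a i.+1.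
    by rewrite big_nat_recr.
  split=> [_ /ideal_add_gen1P[r [y Iy ->]]|sub].
    apply/ideal_add_gen1P; exists (r * a i.+1), y => //.
    by rewrite Ebi; ring.
  set b := \prod_(1 <= j < i.+1) a j in Ebi.
  have : ~ I b.
    apply: (@ulrich_at_not_mem _ m b (\prod_(i.+1 <= j < n.+1) a j)) => //.
      by apply: (mP i.+1) => //; rewrite leqnn.
    by apply: ulI_split; rewrite i1.
  apply; have : I_ i b by apply: mem_ideal_add.
  move=> /sub/ideal_add_gen1P[r [y Iy Eb]].
  have [|u Eu] := @local_unit _ m (1 - r * a i.+1) loc.
    move=> mu; apply: m1; rewrite -(subrK (r * a i.+1) 1).
    by apply: is_idealD => //; apply: is_idealMl.
  suff -> : b = u * y by apply: is_idealMl.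
  have -> : y = b * (1 - r * a i.+1).
    by rewrite mulrBr mulr1 {1}Eb Ebi; ring.
  by rewrite mulrCA [u * _]mulrC Eu mulr1.
- have idI i : (1 <= i <= n)%N -> is_ideal (I_ i).
    by move=> /ulI_[[[]]].
  (* The generator of I_k produced at one stage serves as b at the next. *)
  have step k : (1 <= k <= n)%N -> exists a : nat -> R,
      [/\ forall i, (1 <= i <= k)%N -> m (a i),
          stable_at (\prod_(1 <= j < k.+1) a j) (I_ k)
        & forall i, (1 <= i < k)%N ->
          I_ i = ideal_add (ideal_gen [set \prod_(1 <= j < i.+1) a j]) (I_ i.+1)].
    elim: k => // -[_ _|k IHk /andP[_ kn]].
      have ul1 := ulI_ 1%N (ltnW n2).
      have [b stab1] := ulrich_stable hCM hdim ul1.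
      exists (fun=> b); split=> [i _||i].
      + have := ulrich_at_sub (ulrich_change_generator loc ul1 stab1); apply.
        by case: stab1.
      + by rewrite big_nat1.
      + by case: i.
    have [|a [ma stab Ea]] := IHk; first exact: ltnW kn.
    set b := \prod_(1 <= j < k.+2) a j in stab.
    have kn' : (1 <= k.+1 <= n)%N by exact: ltnW kn.
    have [a0 stab0] := ulrich_stable hCM hdim (ulI_ k.+2 kn).
    have ulI0 := ulrich_change_generator loc (ulI_ k.+2 kn) stab0.
    have ulJ := ulrich_change_generator loc (ulI_ _ kn') stab.
    have [c mc [stabc Ec]] := ulrich_at_factor loc ulI0 ulJ (I_lt k.+1 kn).
    pose a' j := if j == k.+2 then c else a j.
    have Ea' i : (i <= k.+1)%N ->
        \prod_(1 <= j < i.+1) a' j = \prod_(1 <= j < i.+1) a j.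
      move=> ik; apply: eq_big_nat => j /andP[_ ji]; rewrite /a'.
      by rewrite ltn_eqF // (leq_trans ji).
    exists a'; split=> [i /andP[i1 ik]||i /andP[i1]].
    + rewrite /a'; case: eqP => [//|/eqP ik2]; apply: ma.
      by rewrite i1 -ltnS ltn_neqAle ik2.
    + by rewrite big_nat_recr //= Ea' // /a' eqxx.
    + rewrite ltnS => ik; rewrite Ea' //.
      move: ik; rewrite leq_eqVlt => /predU1P[->//|ik].
      by apply: Ea; rewrite i1.
  have [|a [ma stab Ea]] := step n; first by rewrite leqnn ltnW.
  have nn : (1 <= n <= n)%N by rewrite leqnn ltnW.
  exists a; split=> //; first exact: stable_image (idI _ nn) stab.
  have Ib : I (\prod_(1 <= j < n.+1) a j) by case: stab.
  (* Descend from n, absorbing the generator of I_(i+1) into that of I_i. *)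
  have final k i : (1 <= i)%N -> (i + k = n)%N ->
      I_ i = ideal_add (ideal_gen [set \prod_(1 <= j < i.+1) a j]) I.
    elim: k i => [|k IHk] i i1.
      rewrite addn0 => ->; apply/seteqP.
      by split; [exact: sub_ideal_add|apply: ideal_add_min => //; exact: idI].
    rewrite addnS -addSn => ikn.
    have iN : (i < n)%N by rewrite -ikn leq_addr.
    rewrite Ea ?i1 // (IHk i.+1) // (@big_nat_recr _ _ _ i.+1) //=.
    apply/seteqP; split=> x /ideal_add_gen1P[r [y]].
      move=> /ideal_add_gen1P[s [z Iz ->]] ->.
      by apply/ideal_add_gen1P; exists (r + s * a i.+1), z => //; ring.
    by move=> Iy ->; apply/ideal_add_gen1P; exists r, y => //; apply: sub_ideal_add.
  move=> i /andP[i1 iN]; apply: (final (n - i)%N) => //.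
  by rewrite subnKC // (leq_trans iN) // leq_pred.
Qed.
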